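(* Let $f:\{0,1\}^n\to\{0,1\}$ be a monotone Boolean function. Then $Q_E(f)=n$ if and only if $f$ is isomorphic to $\mathrm{AND}_n$.
   Context: For $x,y\in\{0,1\}^n$, $x\preceq y$ means $x_i\le y_i$ for all $i$; $f$ is monotone if $f(x)\le f(y)$ whenever $x\preceq y$. $\mathrm{AND}_n(x)=1$ iff all bits are $1$. Two Boolean functions are isomorphic if one can be obtained from the other by permuting the input variables, negating some input variables, and possibly negating the output. $Q_E(f)$ is the exact quantum query complexity: the minimum number $t$ of queries in a quantum algorithm of the form $U_{t+1}QU_t\cdots QU_1$ applied to a fixed initial state in a Hilbert space with fixed orthonormal basis (the $U_j$ input-independent unitaries; $Q$ multiplies each basis state associated with index $i\in[n]$ by $(-1)^{x_i}$ and fixes basis states associated with no index), followed by a measurement in that basis, whose output equals $f(x)$ with probability $1$ for every input $x$. *)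

(* Defs.v *)
From mathcomp Require Import all_boot all_order all_fingroup all_algebra.
From mathcomp Require Import spectral complex reals.

Set Implicit Arguments.
Unset Strict Implicit.
Unset Printing Implicit Defensive.

Import GRing.Theory Num.Theory.
Local Open Scope ring_scope.

Definition input (n : nat) := {ffun 'I_n -> bool}.

(* Bits are compared through the coercion of bool to nat (false = 0, true = 1). *)
Definition input_le n (x y : input n) : Prop := forall i, (x i <= y i)%N.

Definition monotone n (f : input n -> bool) : Prop :=
  forall x y, input_le x y -> (f x <= f y)%N.

Definition AND n (x : input n) : bool := [forall i, x i].

(* [s] permutes the variables, [a] marks the negated variables, [b] tells
   whether the output is negated. *)
Definition isomorphic n (f g : input n -> bool) : Prop :=
  exists (s : 'S_n) (a : input n) (b : bool),
    forall x, f x = g [ffun i => x (s i) (+) a i] (+) b.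

Section QueryAlgorithm.
Variables (R : realType) (n : nat).
Local Notation C := R[i].

(* The Hilbert space is C^d with its standard basis e_0, ..., e_(d-1), which is
   both the query basis and the measurement basis.  [qa_index k] is the input
   index that e_k is associated with, if any, and [qa_output k] is the value
   returned when the final measurement yields e_k.  [qa_unitary j] is the
   (j+1)-st unitary applied; a t-query run uses only those with j <= t. *)
Record query_algorithm := QueryAlgorithm {
  qa_dim : nat;
  qa_index : 'I_qa_dim -> option 'I_n;
  qa_init : 'cV[C]_qa_dim;
  qa_unitary : nat -> 'M[C]_qa_dim;
  qa_output : 'I_qa_dim -> bool;
  qa_init_norm : \sum_k `|qa_init k ord0| ^+ 2 = 1;
  qa_unitaryP : forall j, qa_unitary j \is unitarymx
}.

Variable A : query_algorithm.

Definition query_mx (x : input n) : 'M[C]_(qa_dim A) :=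
  diag_mx (\row_k if qa_index k is Some i then (-1) ^+ x i else 1).

Fixpoint final_state (t : nat) (x : input n) : 'cV[C]_(qa_dim A) :=
  if t is t'.+1 then qa_unitary A t *m (query_mx x *m final_state t' x)
  else qa_unitary A 0%N *m qa_init A.

Definition output_prob (t : nat) (x : input n) (b : bool) : C :=
  \sum_(k | qa_output k == b) `|final_state t x k ord0| ^+ 2.

End QueryAlgorithm.

Definition exactly_computable (R : realType) n (f : input n -> bool)
    (t : nat) : Prop :=
  exists A : query_algorithm R n, forall x, output_prob A t x (f x) = 1.

(* [QE_is R f t] reads Q_E(f) = t. *)
Definition QE_is (R : realType) n (f : input n -> bool) (t : nat) : Prop :=
  exactly_computable R f t /\
  forall t', exactly_computable R f t' -> (t <= t')%N.

(* Main.v *)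
(** Lower bound: after [t] queries the amplitudes are multilinear polynomials of
    degree at most [t] in the input.  If [f] is isomorphic to [AND_n], the
    amplitude of a correct final state at the unique exceptional input [x0]
    vanishes at every other input, so it has degree [n], and [n <= t].

    Upper bound: what [t] queries can compute from a family of states depends
    only on its Gram matrix, since families with equal Gram matrices differ by
    a unitary.  A query splits the Gram matrix as a sum of positive semidefinite
    kernels, one per queried index, and multiplies each by signs; kernels of
    this kind may be added and multiplied pointwise by positive semidefinite
    ones, which accounts for measurements and adaptivity.

    By induction on the subcubes of dimension [m], a monotone function is there
    an AND, an OR, or computable with [m - 1] queries.  If a variable has no face
    on which the function is an AND or OR of all the others, query it first.
    Otherwise each variable has its 0-face an AND or its 1-face an OR (the
    other two possibilities are immediate).  If all are of the same type, the
    function is true exactly on the points with at most one zero, or with at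
    least two ones; if both types occur, [m = 3].  Explicit algorithms handle
    these cases. *)
Require Import Defs.
From mathcomp Require Import all_boot all_order all_fingroup all_algebra.
From mathcomp Require Import spectral complex reals ring zify.

Set Implicit Arguments.
Unset Strict Implicit.
Unset Printing Implicit Defensive.

Import Order.TTheory GRing.Theory Num.Theory.
Local Open Scope ring_scope.

(** * Families of vectors with equal Gram matrices *)

Section Householder.
Variables (R : realFieldType) (d : nat).
Implicit Types u v w : 'cV[R]_d.

Definition dot u v : R := (u^T *m v) ord0 ord0.

Lemma dotE u v : dot u v = \sum_k u k ord0 * v k ord0.
Proof. by rewrite /dot mxE; apply: eq_bigr => k _; rewrite mxE. Qed.

Lemma dotC u v : dot u v = dot v u.
Proof. by rewrite !dotE; apply: eq_bigr => k _; rewrite mulrC. Qed.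

Lemma dotBl u v w : dot (u - v) w = dot u w - dot v w.
Proof. by rewrite !dotE -sumrB; apply: eq_bigr => k _; rewrite !mxE mulrBl. Qed.

Lemma dotBr u v w : dot w (u - v) = dot w u - dot w v.
Proof. by rewrite !(dotC w) dotBl. Qed.

Lemma dot_eq0 u : dot u u = 0 -> u = 0.
Proof.
rewrite dotE => /eqP; rewrite psumr_eq0 => [/allP u0|k _]; last exact: sqr_ge0.
apply/colP => k; rewrite mxE.
by have /= := u0 k (mem_index_enum _); rewrite mulf_eq0 orbb => /eqP.
Qed.

Lemma dot_isometry (U : 'M[R]_d) u v :
  U^T *m U = 1%:M -> dot (U *m u) (U *m v) = dot u v.
Proof. by move=> hU; rewrite /dot trmx_mul -mulmxA (mulmxA _ U) hU mul1mx. Qed.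

Definition reflection u : 'M[R]_d :=
  1%:M - (2 / dot u u) *: (u *m u^T).

Lemma reflectionE u v : reflection u *m v = v - (2 * dot u v / dot u u) *: u.
Proof.
rewrite mulmxBl mul1mx -scalemxAl -mulmxA.
rewrite (mx11_scalar (u^T *m v)) mul_mx_scalar scalerA -/(dot u v).
by rewrite mulrAC.
Qed.

Lemma reflection_orthogonal u :
  dot u u != 0 -> (reflection u)^T *m reflection u = 1%:M.
Proof.
move=> hu; have -> : (reflection u)^T = reflection u.
  by rewrite /reflection linearB /= linearZ /= trmx1 trmx_mul trmxK.
have flip : reflection u *m u = - u.
  by rewrite reflectionE mulfK // scaler_nat mulr2n opprD addrA subrr add0r.
rewrite {2}/reflection mulmxBr mulmx1 -scalemxAr mulmxA flip mulNmx scalerN.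
by rewrite opprK subrK.
Qed.

(* Reflecting along [U *m v i - w i] sends [U *m v i] to [w i] and, the Gram
   matrices being equal, fixes the vectors already matched. *)
Lemma orthogonal_of_gram (I : finType) (v w : I -> 'cV[R]_d) :
    (forall i j, dot (v i) (v j) = dot (w i) (w j)) ->
  exists2 U : 'M[R]_d, U^T *m U = 1%:M & forall i, U *m v i = w i.
Proof.
move=> eq_gram.
suff [U hU Uv] : exists2 U : 'M[R]_d, U^T *m U = 1%:M &
    forall i, i \in enum I -> U *m v i = w i.
  by exists U => // i; apply: Uv; rewrite mem_enum.
elim: (enum I) => [|i s [U hU Uv]]; first by exists 1%:M; rewrite ?trmx1 ?mulmx1.
set u := U *m v i - w i.
have [/dot_eq0/eqP u0|hu] := eqVneq (dot u u) 0.
  exists U => // j; rewrite inE => /predU1P[->|/Uv //].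
  by apply/eqP; rewrite -subr_eq0.
exists (reflection u *m U).
  by rewrite trmx_mul -mulmxA (mulmxA _ (reflection u)) reflection_orthogonal ?mul1mx.
move=> j; rewrite inE -mulmxA reflectionE => /predU1P[->|js].
  suff -> : 2 * dot u (U *m v i) = dot u u.
    by rewrite divff // scale1r /u opprB addrC subrK.
  rewrite /u !dotBl !dotBr dot_isometry // -(eq_gram i i) (dotC (w i)).
  ring.
suff -> : dot u (U *m v j) = 0 by rewrite mulr0 mul0r scale0r subr0 Uv.
by rewrite dotBl dot_isometry // Uv // eq_gram subrr.
Qed.

End Householder.

(** * Degree lower bound *)

Section LowerBound.
Variables (R : realType) (n : nat).
Implicit Types (A : query_algorithm R n) (f : input n -> bool) (x : input n).
Local Notation C := R[i].

Definition character (T : {set 'I_n}) x : C := \prod_(i in T) (-1) ^+ x i.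

(** The sum factors over the coordinates, and a coordinate in [T] contributes [1 + (-1)]. *)
Lemma sum_character T : T != set0 -> \sum_x character T x = 0.
Proof.
move=> /set0Pn[i iT].
under eq_bigr do rewrite /character big_mkcond /=.
rewrite -(bigA_distr_bigA (fun i b => if i \in T then (-1) ^+ nat_of_bool b else 1)).
by rewrite (bigD1 i) //= iT big_bool /= addNr mul0r.
Qed.

Lemma character_sign T i x : character T x * (-1) ^+ x i =
  character (if i \in T then T :\ i else i |: T) x.
Proof.
rewrite /character; case: ifPn => iT; last by rewrite mulrC big_setU1.
by rewrite (big_setD1 i iT) /= mulrC mulrA -expr2 sqrr_sign mul1r.
Qed.

(* Each query raises the degree of the amplitudes, as multilinear polynomials
   in the input, by at most one; hence they stay orthogonal to the characters
   of degree larger than [t]. *)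
Lemma sum_character_final_state A t (T : {set 'I_n}) :
  (t < #|T|)%N -> \sum_x character T x *: final_state A t x = 0.
Proof.
elim: t T => [|t IH] T ltT /=.
  rewrite -scaler_suml sum_character ?scale0r //.
  by apply: contraTneq ltT => ->; rewrite cards0.
under eq_bigr do rewrite scalemxAr.
rewrite -mulmx_sumr [X in _ *m X](_ : _ = 0) ?mulmx0 //.
apply/colP => k; rewrite summxE mxE.
under eq_bigr do rewrite mxE /query_mx mul_diag_mx !mxE mulrA.
(* The phase at [k] is a character of degree at most one, so it toggles at most one element of
   [T]. *)
suff [T' ltT' eqT] : exists2 T' : {set 'I_n}, (t < #|T'|)%N & forall x,
    character T x * (if qa_index k is Some i then (-1) ^+ x i else 1)
    = character T' x.
  have /(congr1 (fun u : 'cV__ => u k ord0)) := IH T' ltT'.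
  rewrite summxE mxE => sum0; rewrite -[RHS]sum0; apply: eq_bigr => x _.
  by rewrite !mxE -eqT.
case: (qa_index k) => [i|]; last by exists T; [exact: ltnW|move=> x; rewrite mulr1].
exists (if i \in T then T :\ i else i |: T); last by move=> x; rewrite character_sign.
by case: ifP => iT; [move: ltT; rewrite (cardsD1 i) iT|rewrite cardsU1 iT ltnW // ltnW].
Qed.

Lemma sqr_norm_unitary d (U : 'M[C]_d) (u : 'cV[C]_d) : U \is unitarymx ->
  \sum_k `|(U *m u) k ord0| ^+ 2 = \sum_k `|u k ord0| ^+ 2.
Proof.
move=> /unitarymxP/mulmx1C hU.
have E (v : 'cV[C]_d) : \sum_k `|v k ord0| ^+ 2 = (map_mx Num.conj v^T *m v) ord0 ord0.
  by rewrite mxE; apply: eq_bigr => k _; rewrite !mxE normCKC.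
by rewrite !E trmx_mul map_mxM mulmxA -(mulmxA _ _ U) hU mulmx1.
Qed.

Lemma final_state_norm A t x : \sum_k `|final_state A t x k ord0| ^+ 2 = 1.
Proof.
elim: t => [|t IH] /=; rewrite sqr_norm_unitary ?qa_unitaryP ?qa_init_norm //.
rewrite -IH; apply: eq_bigr => k _; rewrite /query_mx mul_diag_mx !mxE normrM.
by case: (qa_index k) => [i|]; rewrite ?normr1 ?mul1r // normrX normrN1 expr1n mul1r.
Qed.

Lemma output_prob_negb A t x b :
  output_prob A t x b = 1 -> forall k, qa_output k = ~~ b -> final_state A t x k ord0 = 0.
Proof.
move=> pb k kb.
have := final_state_norm A t x; rewrite (bigID (fun k => qa_output k == b)) /=.
rewrite -/(output_prob A t x b) pb -[RHS]addr0 => /addrI/eqP.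
rewrite psumr_eq0 => [/allP/(_ k (mem_index_enum _))|j _]; last exact: exprn_ge0.
by rewrite kb; case: b {pb kb} => /=; rewrite expf_eq0 normr_eq0 => /eqP.
Qed.

Lemma isomorphic_AND_singleton f : isomorphic f (@AND n) ->
  exists x0 b, forall x, f x = (x == x0) (+) b.
Proof.
move=> [s [a [b fE]]]; exists [ffun j => ~~ a ((s^-1)%g j)], b => x; rewrite fE.
congr (_ (+) _); apply/forallP/eqP => [h|-> i].
  apply/ffunP => j; rewrite ffunE; have := h ((s^-1)%g j).
  by rewrite ffunE permKV; case: (x j); case: (a _).
by rewrite !ffunE permK; case: (a i).
Qed.

Lemma AND_lower_bound f t :
  isomorphic f (@AND n) -> exactly_computable R f t -> (n <= t)%N.
Proof.
move=> /isomorphic_AND_singleton[x0 [b fE]] [A Af]; rewrite leqNgt; apply/negP => ltn.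
(* The full character has degree [n > t]. At a basis state with output [f x0] all other inputs have
   amplitude zero, so the vanishing sum reduces to its term at [x0]. *)
have := @sum_character_final_state A t [set: 'I_n].
rewrite cardsT card_ord => /(_ ltn) sum0.
have fx0 : f x0 = ~~ b by rewrite fE eqxx.
have /eqP := Af x0; rewrite /output_prob big1 ?(eq_sym 0) ?oner_eq0 // => k /eqP kf.
move/(congr1 (fun u : 'cV__ => u k ord0)): sum0; rewrite summxE mxE.
rewrite (bigD1 x0) //= big1 ?addr0 => [|x /negbTE neq].
  move/eqP; rewrite mxE mulf_eq0 => /orP[|/eqP->]; last by rewrite normr0 expr0n.
  by rewrite prodf_seq_eq0 => /hasP[i _]; rewrite /= signr_eq0 andbF.
rewrite mxE (output_prob_negb (Af x)) ?mulr0 //.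
by rewrite kf fx0 fE neq.
Qed.

End LowerBound.

(** * From Gram kernels to query algorithms *)

Section GramKernels.
Variables (R : realType) (n : nat).
Implicit Types (f : input n -> bool) (x y : input n) (o : option 'I_n).

Definition kernel := input n -> input n -> R.
Definition weighted := (R * (input n -> R))%type.

Definition gram (L : seq weighted) : kernel :=
  fun x y => \sum_(p <- L) p.1 * (p.2 x * p.2 y).

Definition nonneg (L : seq weighted) := all (fun p => 0 <= p.1) L.

(** Positivity is given by a rank-one decomposition, whose terms serve directly as coordinates of
    vectors with Gram matrix [G]. *)
Definition psd (G : kernel) := exists2 L, nonneg L & G =2 gram L.

Definition phase x o : R := if o is Some i then (-1) ^+ x i else 1.

Definition queried (L : seq (option 'I_n * weighted)) : kernel := fun x y =>
  \sum_(p <- L) phase x p.1 * phase y p.1 * (p.2.1 * (p.2.2 x * p.2.2 y)).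

(* [decides f t G]: from a family of states with Gram matrix [G], indexed by
   the input, [t] queries suffice to compute [f] exactly.  A query step splits
   [G] as a sum of positive semidefinite kernels, one for each choice of the
   queried index, and multiplies each by the phases of that index. *)
Fixpoint decides f (t : nat) (G : kernel) : Prop :=
  if t is t'.+1 then
    exists L, [/\ nonneg (map snd L), G =2 gram (map snd L)
                & decides f t' (queried L)]
  else psd G /\ forall x y, f x != f y -> G x y = 0.

End GramKernels.

Section Realization.
Variables (R : realType) (n K : nat).
Implicit Types (f : input n -> bool) (x y : input n).

(* The basis states carry a query index, an output bit, and a work register. *)
Definition label := (option 'I_n * bool)%type.
Definition site := (label * 'I_K)%type.
Local Notation d := #|{: site}|.

Definition site_label (k : 'I_d) : label := (enum_val k).1.
(** Each rank-one term of a kernel gets its own cell of the work register, tagged with a label. *)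
Definition place (l : nat -> label) (a : nat -> R) : 'cV[R]_d :=
  \col_k (if site_label k == l (enum_val k).2 then a (enum_val k).2 else 0).

Definition real_query x : 'M[R]_d := diag_mx (\row_k phase R x (site_label k).1).

Lemma dot_place l l' a b : dot (place l a) (place l' b) =
  \sum_(k < K) if l k == l' k then a k * b k else 0.
Proof.
rewrite dotE (reindex (enum_rank : site -> _)) /=; last first.
  by apply: onW_bij; exact: enum_rank_bij.
pose F (c : label) (k : 'I_K) :=
  (place l a) (enum_rank (c, k)) ord0 * (place l' b) (enum_rank (c, k)) ord0.
transitivity (\sum_c \sum_k F c k).
  by rewrite pair_bigA; apply: eq_bigr => -[].
rewrite exchange_big; apply: eq_bigr => k _ /=.
rewrite /F (bigD1 (l k)) //= big1 ?addr0 => [|c /negbTE cl].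
  by rewrite !mxE /site_label enum_rankK /= eqxx; case: ifP => _; rewrite ?mulr0.
by rewrite !mxE /site_label enum_rankK /= cl mul0r.
Qed.

Lemma query_place x l a :
  real_query x *m place l a = place l (fun k => phase R x (l k).1 * a k).
Proof.
apply/colP => k; rewrite mul_diag_mx !mxE.
by case: eqP => [->|]; rewrite ?mulr0.
Qed.

Fixpoint real_run (U : nat -> 'M[R]_d) (t : nat) x (u : 'cV[R]_d) : 'cV[R]_d :=
  if t is t'.+1 then U t *m (real_query x *m real_run U t' x u) else U 0%N *m u.

(** Peels off the first query instead of the last, to match the recursion of [decides]. *)
Lemma real_runS U t x u : real_run U t.+1 x u =
  real_run (U \o succn) t x (real_query x *m (U 0%N *m u)).
Proof. by elim: t => [|t IH] //=; rewrite -IH. Qed.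

Lemma big_nth_wide (T : Type) (p0 : T) (L : seq T) (F : T -> R) :
  (size L <= K)%N -> F p0 = 0 -> \sum_(p <- L) F p = \sum_(k < K) F (nth p0 L k).
Proof.
move=> leK F0; rewrite (big_nth p0) big_mkord (big_ord_widen K (F \o nth p0 L)) //.
rewrite big_mkcond /=; apply: eq_bigr => k _.
by case: ltnP => // h; rewrite nth_default.
Qed.

End Realization.

Lemma nonneg_nth (R : realType) n (L : seq (weighted R n)) k :
  nonneg L -> 0 <= (nth (0, fun=> 0) L k).1.
Proof.
move=> /all_nthP h; case: (ltnP k (size L)) => kL; first exact: h.
by rewrite nth_default.
Qed.

Lemma sqrt_weight (R : rcfType) (c a b : R) : 0 <= c ->
  Num.sqrt c * a * (Num.sqrt c * b) = c * (a * b).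
Proof. by move=> c0; rewrite mulrACA -expr2 sqr_sqrtr. Qed.

Section Bridge.
Variables (R : realType) (n : nat).
Implicit Types (f : input n -> bool) (x y : input n).

(** Each unitary comes from two families with equal Gram matrices. Every large enough [K] is
    allowed, so that one dimension can serve all steps. *)
Lemma decides_run f t (G : kernel R n) : decides f t G ->
  exists K0, forall K, (K0 <= K)%N ->
  forall u : input n -> 'cV[R]_#|{: site n K}|, (forall x y, dot (u x) (u y) = G x y) ->
  exists2 U, forall j : nat, (U j)^T *m U j = 1%:M &
    forall x k, (site_label k).2 != f x -> real_run U t x (u x) k ord0 = 0.
Proof.
elim: t G => [|t IH] G; rewrite [decides _ _ _]/=.
  move=> [[L L0 GE] Gf]; exists (size L) => K leK u uG.
  pose a x k := let p := nth (0, fun=> 0) L k in Num.sqrt p.1 * p.2 x.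
  (* Target of the last unitary: the output bit is [f x]. Different bits give orthogonal vectors, as
     the vanishing of [G] demands. *)
  pose v x := @place R n K (fun=> (None, f x)) (a x).
  have [|U hU Uv] := @orthogonal_of_gram _ _ _ u v; last first.
    exists (fun=> U) => // x k hk /=; rewrite Uv mxE.
    by rewrite ifN //; apply: contraNneq hk => ->.
  move=> x y; rewrite uG dot_place xpair_eqE eqxx /=.
  case: eqP => [_|/eqP ne]; last by rewrite big1_eq Gf.
  rewrite GE /gram (big_nth_wide (p0 := (0, fun=> 0)) leK) ?mul0r //.
  by apply: eq_bigr => k _; rewrite sqrt_weight ?nonneg_nth.
move=> [L [L0 GE /IH[K0 hK0]]]; exists (maxn K0 (size L)) => K.
rewrite geq_max => /andP[leK0 leK] u uG.
pose p0 : option 'I_n * weighted R n := (None, (0, fun=> 0)).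
pose l k := ((nth p0 L k).1, false).
pose a x k := let p := (nth p0 L k).2 in Num.sqrt p.1 * p.2 x.
have w0 k : 0 <= (nth p0 L k).2.1.
  case: (ltnP k (size L)) => kL; last by rewrite nth_default.
  by rewrite -(nth_map _ p0.2) // nonneg_nth.
(* Target of the first unitary: each term is tagged with the index it queries, so the query produces
   the Gram matrix [queried L]. *)
pose v x := @place R n K l (a x).
have [|V hV Vu] := @orthogonal_of_gram _ _ _ u v.
  move=> x y; rewrite uG dot_place GE /gram big_map.
  rewrite (big_nth_wide (p0 := p0) leK) ?mul0r //.
  by apply: eq_bigr => k _; rewrite eqxx sqrt_weight.
have [|U hU Uf] := hK0 K leK0 (fun x => real_query R K x *m v x).
  move=> x y; rewrite !query_place dot_place /queried.
  rewrite (big_nth_wide (p0 := p0) leK) ?mul0r ?mulr0 //.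
  by apply: eq_bigr => k _; rewrite eqxx mulrACA sqrt_weight.
exists (fun j => if j is j'.+1 then U j' else V); first by case.
by move=> x k hk; rewrite real_runS Vu Uf.
Qed.

Lemma decides_exactly_computable f t :
  decides f t (fun _ _ => 1 : R) -> exactly_computable R f t.
Proof.
(* The successor makes the register nonempty, so a basis vector is available as the initial
   state. *)
move=> /decides_run[K0 /(_ K0.+1 (leqnSn _))].
set d := #|_| => h.
pose u : 'cV[R]_d := delta_mx (enum_rank ((None, false), ord0)) ord0.
have uu : dot u u = 1.
  rewrite dotE (bigD1 (enum_rank ((None, false), ord0))) //= big1 => [|k /negbTE ne].
    by rewrite !mxE !eqxx mulr1 addr0.
  by rewrite !mxE ne mul0r.
have [//|U hU Uf] := h (fun=> u).
pose toC := map_mx (real_complex R).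
have normR (r : R) : `|r%:C%C| ^+ 2 = (r ^+ 2)%:C%C.
  by rewrite normc_def /= expr0n /= addr0 -rmorphXn sqr_sqrtr // sqr_ge0.
have norm_init : \sum_k `|toC _ _ u k ord0| ^+ 2 = 1.
  under eq_bigr do rewrite mxE normR.
  rewrite -rmorph_sum -[RHS](rmorph1 (real_complex R)) -uu dotE.
  by congr (real_complex R _); apply: eq_bigr => k _; rewrite expr2.
have unitaryU j : toC _ _ (U j) \is unitarymx.
  apply/unitarymxP; rewrite [X in _ *m X](_ : _ = toC _ _ (U j)^T).
    by rewrite -map_mxM (mulmx1C (hU j)) map_mx1.
  by apply/matrixP => r s; rewrite !mxE; apply: conj_Creal; rewrite complex_real.
pose A := QueryAlgorithm (fun k : 'I_d => (site_label k).1)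
  (fun k => (site_label k).2) norm_init unitaryU.
exists A => x.
have runE : final_state A t x = toC _ _ (real_run U t x u).
  elim: t {Uf h} => [|t IH] /=; first by rewrite /toC map_mxM.
  rewrite IH /toC !map_mxM; congr (_ *m (_ *m _)).
  apply/matrixP => r s; rewrite !mxE rmorphMn /=; congr (_ *+ _).
  rewrite /phase; case: (site_label r).1 => [i|]; last by rewrite rmorph1.
  by rewrite rmorphXn rmorphN1.
rewrite -[RHS](final_state_norm A t x) [RHS](bigID (fun k => qa_output k == f x)) /=.
rewrite [X in _ + X]big1 ?addr0 // => k hk.
by rewrite runE mxE Uf // normr0 expr0n.
Qed.

End Bridge.

(** * Calculus of Gram kernels *)

Section Decides.
Variables (R : realType) (n : nat).
Implicit Types (f : input n -> bool) (x y : input n) (G H : kernel R n).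
Implicit Types (D : pred (input n)).

Lemma all_allpairs_imply (S T U : Type) (a : pred S) (b : pred T) (c : pred U)
    (h : S -> T -> U) (s : seq S) (t : seq T) :
  (forall p q, a p -> b q -> c (h p q)) -> all a s -> all b t ->
  all c [seq h p q | p <- s, q <- t].
Proof.
move=> abc + bt; elim: s => //= p s IH /andP[ap /IH sc].
by rewrite all_cat sc andbT all_map; apply: sub_all bt => q; exact: abc.
Qed.

Lemma psd_ext G H : G =2 H -> psd G -> psd H.
Proof. by move=> GH [L L0 GL]; exists L => // x y; rewrite -GH. Qed.

Lemma psd_add G H : psd G -> psd H -> psd (fun x y => G x y + H x y).
Proof.
move=> [L L0 GL] [M M0 HM]; exists (L ++ M); first by rewrite /nonneg all_cat; apply/andP.
by move=> x y; rewrite GL HM /gram big_cat.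
Qed.

Lemma psd_mul G H : psd G -> psd H -> psd (fun x y => G x y * H x y).
Proof.
move=> [L L0 GL] [M M0 HM].
exists [seq (p.1 * q.1, fun x => p.2 x * q.2 x) | p <- L, q <- M].
  by apply: all_allpairs_imply L0 M0 => p q; exact: mulr_ge0.
move=> x y; rewrite GL HM /gram big_allpairs_dep /= big_distrl; apply: eq_bigr => p _ /=.
by rewrite big_distrr; apply: eq_bigr => q _ /=; ring.
Qed.

Lemma psd_rank1 (c : R) (v : input n -> R) :
  0 <= c -> psd (fun x y => c * (v x * v y)).
Proof.
move=> c0; exists [:: (c, v)]; first by rewrite /nonneg /= c0.
by move=> x y; rewrite /gram big_seq1.
Qed.

Lemma decides_ext f t G H : G =2 H -> decides f t G -> decides f t H.
Proof.
case: t => [|t] GH.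
  by move=> [pG Gf]; split; [exact: psd_ext pG|move=> x y; rewrite -GH; apply: Gf].
by move=> [L [L0 GL Lt]]; exists L; split => // x y; rewrite -GH.
Qed.

Lemma decides_psd f t G : decides f t G -> psd G.
Proof. by case: t => [[]//|t [L [L0 GL _]]]; exists (map snd L). Qed.

(** Direct sum: the two algorithms run on orthogonal subspaces. *)
Lemma decides_add f t G H :
  decides f t G -> decides f t H -> decides f t (fun x y => G x y + H x y).
Proof.
elim: t G H => [|t IH] G H.
  move=> [pG Gf] [pH Hf]; split; first exact: psd_add.
  by move=> x y ne; rewrite Gf // Hf // addr0.
move=> [L [L0 GL Lt]] [M [M0 HM Mt]]; exists (L ++ M); split.
- by rewrite map_cat /nonneg all_cat; apply/andP.
- by move=> x y; rewrite GL HM map_cat /gram big_cat.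
- by apply: decides_ext (IH _ _ Lt Mt) => x y; rewrite /queried big_cat.
Qed.

(** Tensor product with an idle register whose states have Gram matrix [H]. *)
Lemma decides_mul f t G H :
  psd H -> decides f t G -> decides f t (fun x y => H x y * G x y).
Proof.
move=> pH; elim: t G => [|t IH] G.
  move=> [pG Gf]; split; first exact: psd_mul.
  by move=> x y ne; rewrite Gf // mulr0.
case: (pH) => [M M0 HM] [L [L0 GL Lt]].
exists [seq (p.1, (q.1 * p.2.1, fun x => q.2 x * p.2.2 x)) | q <- M, p <- L]; split.
- rewrite /nonneg all_map; move: L0; rewrite /nonneg all_map => L0.
  by apply: all_allpairs_imply M0 L0 => q p; exact: mulr_ge0.
- move=> x y; rewrite GL HM /gram [RHS]big_map big_allpairs_dep /= big_distrl.
  apply: eq_bigr => q _ /=; rewrite big_map big_distrr; apply: eq_bigr => p _ /=.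
  by ring.
- apply: decides_ext (IH _ Lt) => x y.
  rewrite HM /gram /queried big_allpairs_dep /= big_distrl.
  apply: eq_bigr => q _ /=; rewrite big_distrr; apply: eq_bigr => p _ /=.
  by ring.
Qed.

(** Queries at [None] change nothing. *)
Lemma decides_leq f t t' G : (t <= t')%N -> decides f t G -> decides f t' G.
Proof.
move=> /subnKC <-; elim: (t' - t)%N G => [|k IH] G; first by rewrite addn0.
move=> /IH{}IH; rewrite addnS; have [L L0 GL] := decides_psd IH.
exists [seq (None, p) | p <- L]; rewrite -map_comp map_id; split=> //.
apply: decides_ext IH => x y; rewrite GL /queried big_map /gram.
by apply: eq_bigr => p _ /=; rewrite !mul1r.
Qed.

(** Inputs outside [D] get the zero vector, so [solves] is computation under the promise [D]. *)
Definition indicator D : kernel R n := fun x y => (D x)%:R * (D y)%:R.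
Definition solves D t f := decides f t (indicator D).

Lemma indicator_psd D : psd (indicator D).
Proof.
by apply: psd_ext (psd_rank1 (fun x => (D x)%:R) ler01) => x y; rewrite mul1r.
Qed.

Lemma solves_decides D t f H : psd H ->
  (forall x y, H x y != 0 -> D x && D y) -> solves D t f -> decides f t H.
Proof.
move=> pH HD Dt; apply: decides_ext (decides_mul pH Dt) => x y.
rewrite /indicator; have [->|/HD/andP[-> ->]] := eqVneq (H x y) 0; first by rewrite mul0r.
by rewrite !mulr1.
Qed.

Lemma solves_sub D D' t f : {subset D' <= D} -> solves D t f -> solves D' t f.
Proof.
move=> sub; apply: solves_decides; first exact: indicator_psd.
move=> x y; rewrite /indicator -natrM mulnb pnatr_eq0 eqb0 negbK.
by case/andP => /sub ? /sub ?; apply/andP.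
Qed.

Lemma solves_const D f : {in D &, forall x y, f x = f y} -> solves D 0 f.
Proof.
move=> Df; split; first exact: indicator_psd.
move=> x y; rewrite /indicator; case Dx: (D x); last by rewrite mul0r.
by case Dy: (D y); rewrite ?mulr0 // (Df x y) ?eqxx.
Qed.

(** Superposing the idle query with [i] multiplies the kernel by [(1 + s_i(x) s_i(y)) / 2], which
    tests [x i = y i]; the kernel splits into its two faces. *)
Lemma solves_query (i : 'I_n) D t f :
  solves [pred x | D x & ~~ x i] t f -> solves [pred x | D x & x i] t f ->
  solves D t.+1 f.
Proof.
move=> h0 h1; pose v x : R := (D x)%:R.
exists [:: (None, (2^-1, v)); (Some i, (2^-1, v))]; split.
- by rewrite /nonneg /= invr_ge0 ler0n.
- by move=> x y; rewrite /gram /= !big_cons big_nil /indicator /= -/(v x) -/(v y); field.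
apply: decides_ext (decides_add h0 h1) => x y.
rewrite /queried !big_cons big_nil /indicator /v /=.
by case: (D x); case: (D y); case: (x i); case: (y i) => /=; rewrite ?expr1 ?expr0; field.
Qed.

(** Deutsch's algorithm: superposing [i] and [j] reveals the parity of the two bits in one query, up
    to the factor [s_i(x) s_i(y)], which is positive semidefinite. *)
Lemma solves_xor (i j : 'I_n) D t f :
  solves [pred x | D x & x i == x j] t f -> solves [pred x | D x & x i != x j] t f ->
  solves D t.+1 f.
Proof.
move=> h0 h1; pose v x : R := (D x)%:R.
exists [:: (Some i, (2^-1, v)); (Some j, (2^-1, v))]; split.
- by rewrite /nonneg /= invr_ge0 ler0n.
- by move=> x y; rewrite /gram /= !big_cons big_nil /indicator /= -/(v x) -/(v y); field.
have psdE : psd (fun x y => 1 * ((-1) ^+ x i * (-1) ^+ y i) : R).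
  by apply: (psd_rank1 (fun x : input n => (-1) ^+ x i)); rewrite ler01.
apply: decides_ext (decides_mul psdE (decides_add h0 h1)) => x y.
rewrite /queried !big_cons big_nil /indicator /v /=.
by case: (D x); case: (D y); case: (x i); case: (y i); case: (x j); case: (y j) => /=;
  rewrite ?expr1 ?expr0; field.
Qed.

Lemma solves_depends (s : seq 'I_n) D f :
  {in D &, forall x y, {in s, x =1 y} -> f x = f y} -> solves D (size s) f.
Proof.
elim: s D => [|i s IH] D Df /=; first by apply: solves_const => x y Dx Dy; apply: Df.
by apply: (solves_query (i := i)); apply: IH => x y /andP[Dx xi] /andP[Dy yi] xy;
  apply: Df => // j; rewrite inE => /predU1P[->|/xy//];
  move: xi yi; case: (x i); case: (y i).
Qed.

Lemma solves_depends_leq (s : seq 'I_n) t D f : (size s <= t)%N ->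
  {in D &, forall x y, {in s, x =1 y} -> f x = f y} -> solves D t f.
Proof. by move=> st /solves_depends; exact: decides_leq. Qed.

End Decides.

(** * Thresholds and read-once functions of three variables *)

Section Solvers.
Variables (R : realType) (n : nat).
Implicit Types (f : input n -> bool) (x y : input n) (D : pred (input n)).
Local Notation solves := (solves R).

Definition literal (a : bool) x (i : 'I_n) : bool := x i (+) a.
Definition lsign a (i : 'I_n) x : R := (-1) ^+ literal a x i.

(** The sign due to the negation occurs twice and cancels. *)
Lemma lsign_phase a i x y :
  phase R x (Some i) * phase R y (Some i) = lsign a i x * lsign a i y.
Proof.
by rewrite /phase /lsign /literal; case: (x i); case: (y i); case: a;
  rewrite /= ?expr0 ?expr1; ring.
Qed.

Lemma psd_queried (L : seq (option 'I_n * weighted R n)) :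
  nonneg (map snd L) -> psd (queried L).
Proof.
move=> L0; exists [seq (p.2.1, fun x => phase R x p.1 * p.2.2 x) | p <- L].
  by move: L0; rewrite /nonneg !all_map.
by move=> x y; rewrite /gram big_map; apply: eq_bigr => p _ /=; ring.
Qed.

Section AndOr.
Variables (D : pred (input n)) (i j k : 'I_n) (a : bool).
Let v x : R := (D x)%:R.
Let si := lsign a i.
Let sj := lsign a j.
Let sk := lsign a k.

(* The first query is made in uniform superposition.  In the second, [r] detects
   [x_j <> x_k], in which case the answer is the literal at [i]; the other
   amplitudes solve the orthogonality conditions on the final states. *)
Definition and_or_first : seq (option 'I_n * weighted R n) :=
  [:: (None, (1/4, v)); (Some i, (1/4, v)); (Some j, (1/4, v)); (Some k, (1/4, v))].

Definition and_or_second : seq (option 'I_n * weighted R n) :=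
  let p x := v x * (1 - si x - sj x - sk x) in
  let q x := v x * (1 + si x) in
  let r x := v x * (sj x - sk x) in
  let w x := v x * (1 - si x + sj x + sk x) in
  [:: (None, (1/32, p)); (None, (1/16, q)); (None, (1/16, r));
      (Some i, (1/32, p)); (Some i, (1/16, q)); (Some i, (1/16, r));
      (Some j, (1/32, w)); (Some k, (1/32, w))].

Lemma solves_and_or c f :
  {in D, forall x, f x = (literal a x i && (literal a x j || literal a x k)) (+) c} ->
  solves D 2 f.
Proof.
move=> fE; exists and_or_first; split.
- by rewrite /nonneg /= !divr_ge0 ?ler0n.
- by move=> x y; rewrite /gram /indicator /= !big_cons big_nil /= -/(v x) -/(v y); field.
exists and_or_second; split.
- by rewrite /nonneg /= !divr_ge0 ?ler0n.
(* [p] and [w] are the difference and the sum of [1 - s_i] and [s_j + s_k], so their cross terms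
   cancel; those remaining cancel against [q] and [r]. *)
- move=> x y; rewrite /queried /gram /and_or_first /and_or_second /=.
  rewrite !big_cons !big_nil !(lsign_phase a) /=.
  by rewrite -/(si x) -/(si y) -/(sj x) -/(sj y) -/(sk x) -/(sk y); field.
split; first by apply: psd_queried; rewrite /nonneg /= !divr_ge0 ?ler0n.
move=> x y; rewrite /queried !big_cons big_nil !(lsign_phase a) /= /v.
move=> ne; case Dx: (D x); last by rewrite /=; field.
case Dy: (D y); last by rewrite /=; field.
move: ne; rewrite !fE // /si /sj /sk /lsign.
case: (literal a x i); case: (literal a x j); case: (literal a x k);
case: (literal a y i); case: (literal a y j); case: (literal a y k);
by case: (c) => //= _; rewrite ?expr0 ?expr1; field.
Qed.

End AndOr.

Local Notation lcount a x s := (count (literal a x) s).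

(** If the bits at [i] and [j] agree they decide the majority; otherwise [k] does. *)
Lemma solves_majority3 D i j k a c f :
  {in D, forall x, f x = (2 <= lcount a x [:: i; j; k])%N (+) c} -> solves D 2 f.
Proof.
move=> fE; apply: (solves_xor (i := i) (j := j)).
  apply: (@solves_depends _ _ [:: i]) => x y /andP[Dx xij] /andP[Dy yij] xy.
  rewrite !fE //= /literal -(eqP xij) -(eqP yij) (xy i) ?mem_head //.
  by case: (y i); case: (a); case: (x k); case: (y k).
apply: (@solves_depends _ _ [:: k]) => x y /andP[Dx xij] /andP[Dy yij] xy.
rewrite !fE //= /literal (xy k) ?mem_head //.
by move: xij yij; case: (x i); case: (x j); case: (y i); case: (y j); case: (a).
Qed.

(* Amplitudes [(s_i + s_j + s_k + s_l) / 4] and [(s_p - s_q) / 4] for the six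
   pairs: the former vanishes on ties, away from which the threshold is a
   majority; the latter detects [x_p <> x_q]. *)
Lemma solves_threshold4 D i j k l a c f :
  {in D, forall x, f x = (2 <= lcount a x [:: i; j; k; l])%N (+) c} -> solves D 3 f.
Proof.
move=> fE; pose v x : R := (D x)%:R.
exists [:: (Some i, (1/4, v)); (Some j, (1/4, v)); (Some k, (1/4, v)); (Some l, (1/4, v))].
split.
- by rewrite /nonneg /= !divr_ge0 ?ler0n.
- by move=> x y; rewrite /gram /indicator /= !big_cons big_nil /= -/(v x) -/(v y); field.
pose s p x : R := lsign a p x.
have psd16 w : psd (fun x y : input n => 1/16 * (w x * w y) : R).
  by apply: psd_rank1; rewrite divr_ge0 ?ler0n.
have ne0 (w : input n -> R) x y : 1/16 * (w x * w y) != 0 -> (w x != 0) && (w y != 0).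
  by rewrite !mulf_eq0 !negb_or => /andP[_].
have pair p q r u : {in D, forall x, f x = (2 <= lcount a x [:: p; q; r; u])%N (+) c} ->
    decides f 2 (fun x y => 1/16 * (v x * (s p x - s q x) * (v y * (s p y - s q y)))).
  move=> fE'; apply: (@solves_decides _ _ [pred x | D x & x p != x q]) => //.
  - suff nz x : v x * (s p x - s q x) != 0 -> D x && (x p != x q).
      by move=> x y /(ne0 (fun x => v x * (s p x - s q x)))/andP[/nz /= -> /nz /= ->].
    rewrite /v /s /lsign /literal; case: (D x); last by rewrite mul0r eqxx.
    by case: (x p =P x q) => // ->; rewrite subrr mulr0 eqxx.
  (* Exactly one literal at [p], [q] is true, so only the OR of those at [r], [u] remains. *)
  - apply: (@solves_depends _ _ [:: r; u]) => x y /andP[Dx xpq] /andP[Dy ypq] xy.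
    rewrite !fE' //= /literal (xy r) ?(xy u) ?inE ?eqxx ?orbT //.
    by move: xpq ypq; case: (x p); case: (x q); case: (y p); case: (y q); case: (a).
have sum : decides f 2 (fun x y => 1/16 *
    (v x * (s i x + s j x + s k x + s l x) * (v y * (s i y + s j y + s k y + s l y)))).
  apply: (@solves_decides _ _
    [pred x | D x & s i x + s j x + s k x + s l x != 0]).
  - by apply: (psd16 (fun x => v x * (s i x + s j x + s k x + s l x))).
  - move=> x y /(ne0 (fun x => v x * (s i x + s j x + s k x + s l x))) /=.
    by rewrite /v !mulf_eq0 !pnatr_eq0 !eqb0 !negb_or !negbK.
  - apply: (@solves_majority3 _ i j k a c) => x /andP[Dx].
    rewrite fE //= /s /lsign.
    case: (literal a x i); case: (literal a x j); case: (literal a x k);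
    case: (literal a x l) => //=; rewrite ?expr0 ?expr1 => /eqP[]; ring.
have perm p q r u : perm_eq [:: p; q; r; u] [:: i; j; k; l] ->
    {in D, forall x, f x = (2 <= lcount a x [:: p; q; r; u])%N (+) c}.
  by move=> /seq.permP pe x Dx; rewrite fE // pe.
have [pij pik pil] : [/\ perm_eq [:: i; j; k; l] [:: i; j; k; l],
    perm_eq [:: i; k; j; l] [:: i; j; k; l] & perm_eq [:: i; l; j; k] [:: i; j; k; l]].
  by split; apply/seq.permP => b /=; lia.
have [pjk pjl pkl] : [/\ perm_eq [:: j; k; i; l] [:: i; j; k; l],
    perm_eq [:: j; l; i; k] [:: i; j; k; l] & perm_eq [:: k; l; i; j] [:: i; j; k; l]].
  by split; apply/seq.permP => b /=; lia.
apply: decides_ext (decides_add sum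
  (decides_add (decides_add (pair _ _ _ _ (perm _ _ _ _ pij))
     (decides_add (pair _ _ _ _ (perm _ _ _ _ pik)) (pair _ _ _ _ (perm _ _ _ _ pil))))
   (decides_add (pair _ _ _ _ (perm _ _ _ _ pjk))
     (decides_add (pair _ _ _ _ (perm _ _ _ _ pjl)) (pair _ _ _ _ (perm _ _ _ _ pkl)))))).
move=> x y; rewrite /queried !big_cons big_nil !(lsign_phase a) /=.
rewrite -/(s i x) -/(s j x) -/(s k x) -/(s l x) -/(s i y) -/(s j y) -/(s k y) -/(s l y).
by field.
Qed.

(** Compare two variables. If they differ, the OR of the rest remains. If they agree, query one:
    either both literals are true and the answer is known, or both are false and the threshold
    passes to the rest. Dropping two variables makes sizes 3 and 4 base cases. *)
Lemma solves_threshold2 D (t : seq 'I_n) a c f : uniq t -> (2 < size t)%N ->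
  {in D, forall x, f x = (2 <= lcount a x t)%N (+) c} -> solves D (size t).-1 f.
Proof.
have [m] := ubnP (size t); elim: m t D => // m IH.
case=> [|i [|j [|k [|l [|p t]]]]] // D ltm + _ fE.
- by move=> _; apply: solves_majority3 fE.
- by move=> _; apply: solves_threshold4 fE.
have t'2 : (2 < size [:: k, l, p & t])%N by [].
move: [:: k, l, p & t] t'2 ltm fE => t' t'2 ltm fE /and3P[_ _ t'U].
rewrite /= -(ltn_predK t'2).
apply: (solves_xor (i := i) (j := j)); last first.
  apply: (@solves_depends_leq _ _ t') ; first exact: leqSpred.
  move=> x y /andP[Dx xij] /andP[Dy yij] xy.
  rewrite !fE //=.
  have -> : lcount a x t' = lcount a y t'.
    by apply: eq_in_count => q qt; rewrite /literal xy.
  rewrite /literal; move: xij yij.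
  by case: (x i); case: (x j); case: (y i); case: (y j); case: (a).
have step b : solves [pred x | [pred x | D x & x i == x j] x & x i == b] (size t').-1 f.
  case ab: (b == a).
    apply: IH => // [|x /andP[/andP[Dx /eqP xij] /eqP xb]]; first exact: ltnW.
    by rewrite fE //= /literal -xij xb (eqP ab) addbb.
  apply: (@solves_depends_leq _ _ [::]) => // x y.
  move=> /andP[/andP[Dx /eqP xij] /eqP xb] /andP[/andP[Dy /eqP yij] /eqP yb] _.
  have ba : b (+) a by rewrite -negb_eqb ab.
  by rewrite !fE //= /literal -xij -yij xb yb ba.
apply: (solves_query (i := i));
  [apply: solves_sub (step false)|apply: solves_sub (step true)];
  by move=> x; rewrite !inE; case: (x i).
Qed.

End Solvers.

(** * Monotone functions on subcubes *)

Section MonotoneSubcubes.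
Variables (R : realType) (n : nat) (f : input n -> bool).
Hypothesis f_mono : monotone f.
Implicit Types (x y z : input n) (S : {set 'I_n}).
Local Notation solves := (solves R).

Definition cube S z : pred (input n) := [pred x : input n | [forall i in ~: S, x i == z i]].
Definition all_ones S x := [forall i in S, x i].
Definition some_one S x := [exists i in S, x i].
Definition update z (i : 'I_n) b : input n := [ffun j => if j == i then b else z j].
Definition graft S (p : pred 'I_n) z : input n := [ffun j => if j \in S then p j else z j].

Lemma cubeP S z x : reflect (forall i, i \notin S -> x i = z i) (x \in cube S z).
Proof.
apply: (iffP forall_inP) => h i; first by move=> iS; apply/eqP/h; rewrite inE.
by rewrite inE => /h/eqP.
Qed.

Lemma graft_cube S p z : graft S p z \in cube S z.
Proof. by apply/cubeP => i /negbTE iS; rewrite ffunE iS. Qed.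

Lemma eq_graft S (p : pred 'I_n) z x :
  x \in cube S z -> {in S, x =1 p} -> x = graft S p z.
Proof.
move=> /cubeP xz xp; apply/ffunP => i; rewrite ffunE.
by case: ifPn => [/xp|/xz].
Qed.

Lemma update_cube S z x i b : i \in S -> x \in cube S z -> update x i b \in cube S z.
Proof.
move=> iS /cubeP xz; apply/cubeP => j jS; rewrite ffunE.
by case: eqP jS => [->|_ /xz //]; rewrite iS.
Qed.

Lemma cube_face S z x i : i \in S -> x \in cube S z -> x \in cube (S :\ i) (update z i (x i)).
Proof.
move=> iS /cubeP xz; apply/cubeP => j; rewrite !inE negb_and negbK ffunE.
by case: eqP => [->|_ /xz].
Qed.

Lemma mono_le x y : (forall i, x i -> y i) -> f x -> f y.
Proof.
move=> xy fx; have := f_mono (x := x) (y := y); rewrite fx lt0b; apply => i.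
by case: (x i) (xy i) => // ->.
Qed.

Lemma some_oneD1 S i x : i \in S -> some_one S x = x i || some_one (S :\ i) x.
Proof.
move=> iS; apply/exists_inP/orP => [[j jS xj]|[xi|/exists_inP[j /setD1P[_ jS] xj]]].
- have [<-|ne] := eqVneq j i; first by left.
  by right; apply/exists_inP; exists j; rewrite // !inE ne.
- by exists i.
- by exists j.
Qed.

Lemma all_onesD1 S i x : i \in S -> all_ones S x = x i && all_ones (S :\ i) x.
Proof.
move=> iS; apply/forall_inP/andP => [h|[xi /forall_inP h] j jS].
  by split; [exact: h|apply/forall_inP => j /setD1P[_ /h]].
by have [->//|ne] := eqVneq j i; apply: h; rewrite !inE ne.
Qed.

Lemma some_one1 i x : some_one [set i] x = x i.
Proof.
by apply/exists_inP/idP => [[j /set1P->//]|xi]; exists i; rewrite ?set11.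
Qed.

Lemma all_ones1 i x : all_ones [set i] x = x i.
Proof.
apply/forall_inP/idP => [h|xi j /set1P->//]; exact/h/set11.
Qed.

Lemma eq_all_ones S x y : {in S, x =1 y} -> all_ones S x = all_ones S y.
Proof. by move=> xy; apply: eq_forallb_in => i iS; rewrite xy. Qed.

Lemma eq_some_one S x y : {in S, x =1 y} -> some_one S x = some_one S y.
Proof.
move=> xy; apply/exists_inP/exists_inP => -[i iS xi]; exists i => //.
  by rewrite -xy.
by rewrite xy.
Qed.

Definition easy S z := [\/ solves (cube S z) #|S|.-1 f,
  {in cube S z, f =1 all_ones S} | {in cube S z, f =1 some_one S}].

Lemma easy_depends S z i : i \in S ->
  {in cube S z &, forall x y, {in S :\ i, x =1 y} -> f x = f y} -> easy S z.
Proof.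
move=> iS dep; apply: Or31; apply: (@solves_depends_leq _ _ (enum (S :\ i))).
  by rewrite -cardE (cardsD1 i S) iS.
by move=> x y Dx Dy xy; apply: dep => // j jS; apply: xy; rewrite mem_enum.
Qed.

(** Let [p] have its only one in [S] at [i]. If [f p] holds, [f] is the OR over [S]; if not, the
    1-face is the same OR and [f] ignores [i]. *)
Lemma easy_face_some_one S z i : i \in S ->
  {in cube S z, forall x, ~~ x i -> f x = some_one (S :\ i) x} -> easy S z.
Proof.
move=> iS f0; pose p := graft S (pred1 i) z.
have [fp|nfp] := boolP (f p).
  apply: Or33 => x xS; rewrite (some_oneD1 _ iS); case xi: (x i) => /=; last by rewrite f0 ?xi.
  apply: mono_le fp => j; rewrite ffunE; case: ifPn => [_ /= /eqP->//|jS].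
  by rewrite (cubeP _ _ _ xS).
apply: (easy_depends iS).
suff fE : {in cube S z, f =1 some_one (S :\ i)}.
  by move=> x y xS yS xy; rewrite !fE //; apply: eq_some_one.
move=> x xS; case xi: (x i); last by rewrite f0 ?xi.
have [one|none] := boolP (some_one (S :\ i) x).
  have: f (update x i false).
    rewrite f0 ?update_cube ?ffunE ?eqxx // -(eq_some_one (x := x)) // => j.
    by rewrite !inE ffunE => /andP[/negbTE->].
  by apply: mono_le => j; rewrite ffunE; case: ifP.
rewrite -(negbTE nfp); congr f; apply: eq_graft => // j jS /=.
have [->//|ne] := eqVneq j i; apply: contraNF none => xj.
by apply/exists_inP; exists j; rewrite // !inE ne.
Qed.

(** Dual of the previous lemma, with the only zero at [i]. *)
Lemma easy_face_all_ones S z i : i \in S ->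
  {in cube S z, forall x, x i -> f x = all_ones (S :\ i) x} -> easy S z.
Proof.
move=> iS f1; pose p := graft S (predC1 i) z.
have [fp|nfp] := boolP (f p); last first.
  apply: Or32 => x xS; rewrite (all_onesD1 _ iS); case xi: (x i) => /=; first by rewrite f1.
  apply: contraNF nfp; apply: mono_le => j; rewrite ffunE.
  case: ifPn => [_ xj /=|jS]; first by apply: contraTneq xj => ->; rewrite xi.
  by rewrite (cubeP _ _ _ xS).
apply: (easy_depends iS).
suff fE : {in cube S z, f =1 all_ones (S :\ i)}.
  by move=> x y xS yS xy; rewrite !fE //; apply: eq_all_ones.
move=> x xS; case xi: (x i); first by rewrite f1.
have [ones|zero] := boolP (all_ones (S :\ i) x).
  rewrite -fp; congr f; apply: eq_graft => // j jS /=.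
  have [->|ne] := eqVneq j i; first by rewrite xi.
  by apply: (forall_inP ones); rewrite !inE ne.
apply: contraNF zero => fx; rewrite (eq_all_ones (y := update x i true)).
  rewrite -f1 ?update_cube ?ffunE ?eqxx //.
  by apply: mono_le fx => j; rewrite ffunE; case: ifP.
by move=> j; rewrite !inE ffunE => /andP[/negbTE->].
Qed.

(** The two face types left open by the preceding lemmas: a 0-face that is an AND and a 1-face that
    is an OR. *)
Definition face_all S z i := [forall x in cube S z, ~~ x i ==> (f x == all_ones (S :\ i) x)].
Definition face_some S z i := [forall x in cube S z, x i ==> (f x == some_one (S :\ i) x)].

Lemma face_allP S z i : face_all S z i ->
  {in cube S z, forall x, ~~ x i -> f x = all_ones (S :\ i) x}.
Proof. by move=> /forall_inP h x /h/implyP{}h /h/eqP. Qed.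

Lemma face_someP S z i : face_some S z i ->
  {in cube S z, forall x, x i -> f x = some_one (S :\ i) x}.
Proof. by move=> /forall_inP h x /h/implyP{}h /h/eqP. Qed.

Lemma easy_or_face S z i : i \in S -> (1 < #|S|)%N ->
  (forall b, easy (S :\ i) (update z i b)) ->
  easy S z \/ face_all S z i || face_some S z i.
Proof.
move=> iS ltS faces.
have face b x : x \in cube S z -> x i = b -> x \in cube (S :\ i) (update z i b).
  by move=> xS <-; exact: cube_face.
case: (faces false) => [s0|f0|f0].
- case: (faces true) => [s1|f1|f1].
  + left; apply: Or31; move: ltS s0 s1; rewrite (cardsD1 i) iS /=.
    case: #|S :\ i| => // m _ s0 s1.
    apply: (solves_query (i := i)); [apply: solves_sub s0|apply: solves_sub s1].
      by move=> x /andP[xS /negbTE xi]; exact: face.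
    by move=> x /andP[xS xi]; exact: face.
  + by left; apply: (easy_face_all_ones iS) => x xS xi; apply: f1; exact: face.
  + right; apply/orP; right; apply/forall_inP => x xS; apply/implyP => xi.
    by apply/eqP/f1/face.
- right; apply/orP; left; apply/forall_inP => x xS; apply/implyP => /negbTE xi.
  by apply/eqP/f0/face.
- by left; apply: (easy_face_some_one iS) => x xS /negbTE xi; apply: f0; exact: face.
Qed.

Lemma count_literal S a x :
  count (literal a x) (enum S) = #|[set i in S | literal a x i]|.
Proof.
rewrite -sum1_card -sum1_count big_enum_cond /=.
by apply: eq_bigl => i; rewrite inE.
Qed.

(** Here [f] is true when at most one variable of [S] is zero: the negated threshold two on negated
    literals. *)
Lemma easy_faces_all S z : (2 < #|S|)%N ->
  {in S, forall i, face_all S z i} -> easy S z.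
Proof.
move=> ltS fA; apply: Or31; rewrite cardE.
apply: (@solves_threshold2 _ _ _ _ true true); rewrite ?enum_uniq -?cardE //.
move=> x xS; rewrite count_literal addbT -leqNgt.
have zE i : i \in S -> ~~ x i ->
    f x = (#|[set j in S | literal true x j]| <= 1)%N.
  move=> iS xi; rewrite (face_allP (fA i iS)) // (cardsD1 i) !inE iS /literal addbT xi.
  rewrite add1n ltnS leqn0 cards_eq0; apply/forall_inP/eqP => [h|h j /setD1P[ne jS]].
    apply/setP => j; rewrite !inE /literal; apply/negbTE.
    by apply/and3P => -[ne jS]; rewrite addbT h // !inE ne.
  by have /setP/(_ j) := h; rewrite !inE ne jS /literal addbT => /negbFE.
have [/exists_inP[i iS xi]|/exists_inPn ones] := boolP [exists i in S, ~~ x i].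
  exact: zE xi.
rewrite (_ : [set j in S | _] = set0) ?cards0; last first.
  apply/setP => j; rewrite !inE /literal addbT; apply/negbTE/andP => -[jS].
  exact/negP/ones.
(* With no zero in [S], no 0-face contains the point; lower one coordinate, apply its face, and
   return by monotonicity. *)
have /card_gt0P[i iS] : (0 < #|S|)%N by exact: leq_trans ltS.
have uS : update x i false \in cube S z by exact: update_cube.
have : f (update x i false).
  rewrite (face_allP (fA i iS)) // ?ffunE ?eqxx //.
  apply/forall_inP => j /setD1P[/negbTE ne jS]; rewrite ffunE ne.
  by have := ones j jS; rewrite negbK.
by apply: mono_le => j; rewrite ffunE; case: ifP.
Qed.

Lemma easy_faces_some S z : (2 < #|S|)%N ->
  {in S, forall i, face_some S z i} -> easy S z.
Proof.
move=> ltS fB; apply: Or31; rewrite cardE.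
apply: (@solves_threshold2 _ _ _ _ false false); rewrite ?enum_uniq -?cardE //.
move=> x xS; rewrite count_literal addbF.
have zE y i : y \in cube S z -> i \in S -> y i ->
    f y = (1 < #|[set j in S | literal false y j]|)%N.
  move=> yS iS yi; rewrite (face_someP (fB i iS)) // (cardsD1 i) !inE iS /literal addbF yi.
  rewrite add1n ltnS card_gt0; apply/exists_inP/set0Pn => -[j].
    by move=> /setD1P[ne jS] yj; exists j; rewrite !inE ne jS /literal addbF.
  by rewrite !inE /literal addbF => /and3P[ne jS yj]; exists j; rewrite // !inE ne.
have [/exists_inP[i iS xi]|/exists_inPn zeros] := boolP [exists i in S, x i].
  exact: zE xi.
rewrite (_ : [set j in S | _] = set0) ?cards0; last first.
  apply/setP => j; rewrite !inE /literal addbF; apply/negbTE/andP => -[jS].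
  exact/negP/zeros.
have /card_gt0P[i iS] : (0 < #|S|)%N by exact: leq_trans ltS.
have uS : update x i true \in cube S z by exact: update_cube.
have : ~~ f (update x i true).
  rewrite (face_someP (fB i iS)) // ?ffunE ?eqxx //.
  apply/exists_inPn => j /setD1P[/negbTE ne jS]; rewrite ffunE ne.
  exact: zeros.
by apply: contraNF; apply: mono_le => j; rewrite ffunE; case: ifP.
Qed.

Lemma easy_mixed_faces S z i k : (2 < #|S|)%N -> i \in S -> k \in S -> i != k ->
  face_all S z i -> face_some S z k -> easy S z.
Proof.
move=> ltS iS kS ik fA fB; pose T := S :\ i :\ k.
have kSi : k \in S :\ i by rewrite !inE eq_sym ik.
have cardS : #|S| = #|T|.+2 by rewrite (cardsD1 i) iS (cardsD1 k) kSi.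
(* For distinct [l], [m] in [T], the point with ones in [S] only at [k] and [l] would be false by
   the 0-face of [i] and true by the 1-face of [k]. *)
have /cards1P[l Tl] : #|T| == 1%N.
  rewrite eqn_leq andbC; apply/andP; split; first by rewrite cardS in ltS.
  rewrite leqNgt; apply/card_gt1P => -[l [m []]].
  move=> /setD1P[lk /setD1P[li lS]] /setD1P[mk /setD1P[mi mS]] lm.
  pose x := graft S (pred2 k l) z; have xS : x \in cube S z := graft_cube _ _ _.
  have := face_allP fA xS; rewrite ffunE iS /= (negbTE ik) (eq_sym i) (negbTE li) => /(_ isT).
  have := face_someP fB xS; rewrite ffunE kS /= eqxx => /(_ isT) ->.
  have -> : some_one (S :\ k) x.
    by apply/exists_inP; exists l; rewrite ?ffunE ?inE ?lk ?lS //= eqxx orbT.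
  move=> /esym/forall_inP/(_ m); rewrite !inE mi mS ffunE mS /= (negbTE mk).
  by rewrite eq_sym (negbTE lm) => /(_ isT).
have f0 x : x \in cube S z -> ~~ x i -> f x = x k && x l.
  by move=> xS xi; rewrite (face_allP fA) // (all_onesD1 _ kSi) -/T Tl all_ones1.
have iSk : i \in S :\ k by rewrite !inE ik.
have Tl' : S :\ k :\ i = [set l].
  by rewrite -Tl; apply/setP => j; rewrite !inE andbCA.
have f1 x : x \in cube S z -> x k -> f x = x i || x l.
  by move=> xS xk; rewrite (face_someP fB) // (some_oneD1 _ iSk) Tl' some_one1.
have ST : S = [set i; k; l].
  by rewrite -(setD1K iS) -(setD1K kSi) -/T Tl setUA.
have lik : (l != i) && (l != k).
  by have := set11 l; rewrite -Tl !inE => /and3P[-> ->].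
(* The faces leave [f] open only where [i] is one and [k] is zero; there it is a monotone function
   of [l]. *)
pose p b := f (graft S [pred j | if j == l then b else j == i] z).
have f2 x : x \in cube S z -> x i -> ~~ x k -> f x = p (x l).
  move=> xS xi xk; congr f; apply: eq_graft => // j; rewrite ST !inE /=.
  have [->//|nl] := eqVneq j l; rewrite orbF => /orP[]/eqP->; first by rewrite eqxx.
  by rewrite eq_sym (negbTE ik) (negbTE xk).
have p01 : p false -> p true.
  by apply: mono_le => j; rewrite !ffunE /=; case: ifP => //; case: ifP.
have fE x : x \in cube S z ->
    f x = if x i then (if x k then true else p (x l)) else x k && x l.
  move=> xS; case xi: (x i); last by rewrite f0 ?xi.
  by case xk: (x k); [rewrite f1 ?xi|rewrite f2 ?xi ?xk].
apply: Or31; rewrite cardS Tl cards1 /=.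
(* The three choices of [p] give [i] or ([k] and [l]), the majority, and [k] and ([i] or [l]). The
   first is negated to fit [solves_and_or]. *)
case p0: (p false); [|case p1: (p true)].
- apply: (@solves_and_or _ _ _ i k l true true) => x /fE->.
  rewrite /literal; case: (x i); case: (x k); case: (x l) => //.
  exact: p01.
- apply: (@solves_majority3 _ _ _ i k l false false) => x /fE->.
  by rewrite /= /literal; case: (x i); case: (x k); case: (x l); rewrite ?p0 ?p1.
- apply: (@solves_and_or _ _ _ k i l false false) => x /fE->.
  by rewrite /= /literal; case: (x i); case: (x k); case: (x l); rewrite ?p0 ?p1.
Qed.

Lemma monotone_easy S z : S != set0 -> easy S z.
Proof.
have [m] := ubnP #|S|; elim: m S z => // m IH S z ltm S0.
have [gt1|le1] := ltnP 1 #|S|; last first.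
  have /cards1P[i Si] : #|S| == 1%N by rewrite eqn_leq le1 card_gt0.
  have iS : i \in S by rewrite Si set11.
  (* In dimension one [f] is constant or equal to its variable. *)
  have [f0|nf0] := boolP (f (graft S pred0 z)).
    apply: (easy_depends iS) => x y xS yS _.
    have ft w : w \in cube S z -> f w.
      move=> wS; apply: mono_le f0 => j; rewrite ffunE.
      by case: ifPn => // jS; rewrite (cubeP _ _ _ wS).
    by rewrite !ft.
  have [f1|nf1] := boolP (f (graft S predT z)).
    apply: Or32 => x xS; rewrite Si all_ones1; case xi: (x i).
      rewrite -f1; congr f; apply: eq_graft => // j; rewrite Si => /set1P->.
      by rewrite xi.
    rewrite -(negbTE nf0); congr f; apply: eq_graft => // j; rewrite Si => /set1P->.
    by rewrite xi.
  apply: (easy_depends iS) => x y xS yS _.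
  have ff w : w \in cube S z -> f w = false.
    move=> wS; apply: contraNF nf1; apply: mono_le => j; rewrite ffunE.
    by case: ifPn => // jS; rewrite (cubeP _ _ _ wS).
  by rewrite !ff.
have faces i : i \in S -> easy S z \/ face_all S z i || face_some S z i.
  move=> iS; apply: easy_or_face => // b; apply: IH.
    by move: ltm; rewrite (cardsD1 i) iS.
  by rewrite -card_gt0; move: gt1; rewrite (cardsD1 i) iS.
have [/exists_inP[i iS none]|/exists_inPn allAB] :=
    boolP [exists i in S, ~~ (face_all S z i || face_some S z i)].
  by case: (faces i iS) => // some; rewrite some in none.
have AB i : i \in S -> face_all S z i || face_some S z i.
  by move=> /allAB; rewrite negbK.
have [gt2|le2] := ltnP 2 #|S|; last first.
  have /card_gt0P[i iS] : (0 < #|S|)%N by exact: ltnW.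
  have /cards1P[j Sj] : #|S :\ i| == 1%N.
    by move: gt1 le2; rewrite (cardsD1 i) iS; lia.
  (* On the single remaining variable AND and OR coincide, so each face type is also the other
     one. *)
  case/orP: (AB i iS) => h.
    by apply: (easy_face_some_one iS) => x xS xi; rewrite (face_allP h) // Sj all_ones1 some_one1.
  by apply: (easy_face_all_ones iS) => x xS xi; rewrite (face_someP h) // Sj all_ones1 some_one1.
have [/forall_inP allA|/forall_inPn[k kS nA]] := boolP [forall i in S, face_all S z i].
  exact: easy_faces_all.
have [/forall_inP allB|/forall_inPn[i iS nB]] := boolP [forall i in S, face_some S z i].
  exact: easy_faces_some.
have A : face_all S z i by have := AB i iS; rewrite (negbTE nB) orbF.
have B : face_some S z k by have := AB k kS; rewrite (negbTE nA).
by apply: (easy_mixed_faces gt2 iS kS _ A B); apply: contraNneq nA => <-.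
Qed.

End MonotoneSubcubes.

(** * Passage to the whole cube *)

Lemma isomorphic_AND_all_ones n (f : input n -> bool) :
  f =1 all_ones setT -> isomorphic f (@AND n).
Proof.
move=> fE; exists 1%g, [ffun=> false], false => x; rewrite fE addbF.
by apply/forall_inP/forallP => h i; have := h i; rewrite !ffunE perm1 addbF ?inE // => ->.
Qed.

Lemma isomorphic_AND_some_one n (f : input n -> bool) :
  f =1 some_one setT -> isomorphic f (@AND n).
Proof.
move=> fE; exists 1%g, [ffun=> true], true => x; rewrite fE addbT.
apply/exists_inP/forallPn => -[j]; last first.
  by rewrite !ffunE perm1 addbT negbK; exists j.
by move=> _ xj; exists j; rewrite !ffunE perm1 addbT negbK.
Qed.

Lemma solves_exactly_computable (R : realType) n (D : pred (input n)) t (f : input n -> bool) :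
  (forall x, D x) -> solves R D t f -> exactly_computable R f t.
Proof.
move=> DT Df; apply: decides_exactly_computable; apply: decides_ext Df => x y.
by rewrite /indicator !DT mulr1.
Qed.

Theorem theorem3 (R : realType) (n : nat) (f : input n -> bool) :
  monotone f -> (QE_is R f n <-> isomorphic f (@AND n)).
Proof.
move=> f_mono; have cubeT (x z : input n) : cube setT z x.
  by apply/cubeP => i; rewrite inE.
split=> [[_ min_n]|iso]; last first.
  split; last by move=> t; exact: AND_lower_bound.
  apply: (@solves_exactly_computable _ _ xpredT) => //.
  apply: (@solves_depends_leq _ _ (enum 'I_n)); first by rewrite size_enum_ord.
  by move=> x y _ _ xy; congr f; apply/ffunP => i; apply: xy; rewrite mem_enum.
(* For [n = 0] there is a single input: the empty AND is true and the empty OR false, covering both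
   constants. *)
have [n0|n_gt0] := posnP n.
  have zE (x y : input n) : x = y by apply/ffunP => -[i hi]; exfalso; rewrite n0 in hi.
  pose z : input n := [ffun=> true]; case fz: (f z).
    apply: isomorphic_AND_all_ones => x; rewrite (zE x z) fz.
    by apply/esym/forall_inP => i _; rewrite ffunE.
  apply: isomorphic_AND_some_one => x; rewrite (zE x z) fz.
  by apply/esym/exists_inP => -[[i hi]]; exfalso; rewrite n0 in hi.
have nT : [set: 'I_n] != set0 by rewrite -card_gt0 cardsT card_ord.
pose z : input n := [ffun=> true].
case: (monotone_easy R f_mono z nT) => [|fE|fE].
- rewrite cardsT card_ord => /(solves_exactly_computable (cubeT^~ z))/min_n.
  by rewrite leqNgt prednK ?leqnn.
- by apply: isomorphic_AND_all_ones => x; apply: fE; exact: cubeT.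
- by apply: isomorphic_AND_some_one => x; apply: fE; exact: cubeT.
Qed.
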